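(* Let $a,b\in\mathbb{P}$, $(\alpha,\beta)\in\mathrm{BP}(a,b)$, $l\in\mathbb{N}$, and let $s=((i_1,j_1),\ldots,(i_l,j_l))$ be a progression for a vacancy-osculation set $S\in\mathrm{VOS}(a,b,\alpha,\beta,l)$. Then there exists an oscillating tableau $\eta(s)$ of shape $\lambda_{a,b,\alpha,\beta}$ and length $l$ with the profile $$\Omega(\eta(s))=(j_1-i_1,\ldots,j_l-i_l).$$ Furthermore, $\eta(s)$ has the same number of deletions as the number of osculations of $S$, i.e. $\mathcal{D}(\eta(s))=\chi(S)$, and if $s$ is a canonical ordering of $S$, then, for each $k\in[l]$, $k$ is a deletion of $\eta(s)$ if and only if $(i_k,j_k)$ is an osculation of $S$.
   Context: Notation: $\mathbb{P}$ is the set of positive integers, $\mathbb{N}$ the set of nonnegative integers, $[m,n]=\{m,m+1,\ldots,n\}$ ($=\emptyset$ if $n<m$), $[n]=[1,n]$. Osculating paths. For $a,b\in\mathbb{P}$, $[a]\times[b]$ is a rectangle of lattice points with matrix labelling ($(i,j)$ is in row $i$ from the top and column $j$ from the left). $\mathrm{BP}(a,b)$ is the set of pairs $(\alpha,\beta)$ with $\alpha\subset[a]$, $\beta\subset[b]$, $|\alpha|=|\beta|$; elements are labelled in increasing order, $\alpha=\{\alpha_1<\ldots<\alpha_r\}$, $\beta=\{\beta_1<\ldots<\beta_r\}$. For $x\in[a]$, $y\in[b]$, $\Pi(a,b,x,y)$ is the set of paths $Q=(Q_0,\ldots,Q_L)$ with $Q_0=(a,y)$, $Q_L=(x,b)$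 and each step $Q_m-Q_{m-1}\in\{(0,1),(-1,0)\}$. For $x<x'$ and $y<y'$, paths $Q\in\Pi(a,b,x,y)$ and $Q'\in\Pi(a,b,x',y')$ are osculating if whenever $Q_m=Q'_{m'}=(i,j)$, then $Q_{m-1}=(i,j-1)$, $Q_{m+1}=(i-1,j)$, $Q'_{m'-1}=(i+1,j)$ (unless $m'=0$) and $Q'_{m'+1}=(i,j+1)$ (unless $Q'_{m'}$ is the last point of $Q'$). $\mathrm{OP}(a,b,\alpha,\beta)$ is the set of $r$-tuples $P=(P_1,\ldots,P_r)$ with $P_k\in\Pi(a,b,\alpha_k,\beta_k)$ and $P_k,P_{k+1}$ osculating for each $k\in[r-1]$; $\mathrm{OP}(a,b)$ is the union of these over all $(\alpha,\beta)\in\mathrm{BP}(a,b)$. A vacancy of $P$ is a point of $[a]\times[b]$ on no path of $P$; an osculation of $P$ is a point on two paths of $P$. $Z(P)$ is the set of all vacancies and osculations of $P$. $\mathrm{VOS}(a,b)=\{Z(P)\mid P\in\mathrm{OP}(a,b)\}$ and $\mathrm{VOS}(a,b,\alpha,\beta,l)=\{Z(P)\mid P\in\mathrm{OP}(a,b,\alpha,\beta),\,|Z(P)|=l\}$; elements are called vacancy-osculation sets. The map $P\mapsto Z(P)$ is injective on $\mathrm{OP}(a,b)$, so for $S=Z(P)$ the osculations of $S$ are defined to be those of $P$, and $\chi(S)$ is their number. Progressions. An ordering of a finite set is a tuple listing all its elements once. A canonical ordering of a finite $T\subset\mathbb{Z}^2$ is an ordering $((i_1,j_1),\ldots,(i_{|T|},j_{|T|}))$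 such that $i_k<i_m$ or $j_k<j_m$ whenever $k<m$. A progression for $S\in\mathrm{VOS}(a,b,\alpha,\beta,l)$ is an ordering $(s_1,\ldots,s_l)$ of $S$ with $\{s_1,\ldots,s_k\}\in\mathrm{VOS}(a,b)$ for each $k\in[0,l]$. Partitions. A partition is a weakly decreasing infinite sequence $\lambda=(\lambda_1,\lambda_2,\ldots)$ of nonnegative integers with finitely many nonzero terms; $\ell(\lambda)$ is the number of nonzero terms, $|\lambda|$ the sum, $\lambda^t$ the conjugate, $Y(\lambda)=\{(i,j)\in\mathbb{P}^2\mid i\le\ell(\lambda),\,j\le\lambda_i\}$, and $\emptyset$ is the empty partition. For integers $\gamma_1>\ldots>\gamma_r\ge0$ and $\delta_1>\ldots>\delta_r\ge0$, $(\gamma_1,\ldots,\gamma_r\,|\,\delta_1,\ldots,\delta_r)$ (Frobenius notation) is the unique partition $\lambda$ with exactly $r$ indices $i$ satisfying $\lambda_i\ge i$, and with $\lambda_i-i=\gamma_i$, $\lambda^t_i-i=\delta_i$ for $i\in[r]$. For $\lambda$ with $\ell(\lambda)\le a$ and $\lambda_1\le b$, $[a]\times[b]\setminus\lambda:=(b-\lambda_a,b-\lambda_{a-1},\ldots,b-\lambda_1)$. For $(\alpha,\beta)\in\mathrm{BP}(a,b)$, $\lambda_{a,b,\alpha,\beta}:=[a]\times[b]\setminus(b-\beta_1,\ldots,b-\beta_r\,|\,a-\alpha_1,\ldots,a-\alpha_r)$. Partitions $\lambda,\mu$ differ by a square, $\lambda\sim\mu$, if one of $Y(\lambda),Y(\mu)$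 is the disjoint union of the other and a single point $(i,j)$; then $\Delta(\lambda,\mu):=j-i$. Oscillating tableaux. An oscillating tableau of shape $\lambda$ and length $l$ is a sequence $\eta=(\eta_0=\emptyset,\eta_1,\ldots,\eta_l=\lambda)$ of partitions with $\eta_{k-1}\sim\eta_k$ for $k\in[l]$. Its profile is $\Omega(\eta)=(\Delta(\eta_0,\eta_1),\ldots,\Delta(\eta_{l-1},\eta_l))$; an oscillating tableau is uniquely determined by its profile, so $\eta(s)$ is unique. A deletion of $\eta$ is a $k\in[l]$ with $|\eta_k|=|\eta_{k-1}|-1$, and $\mathcal{D}(\eta)$ is the number of deletions. *)

(* Defs.v *)
(* MathComp, with finmap for finite sets of lattice points and boolp for the
   truth value [`[< _ >]] of a proposition. *)
From mathcomp Require Import all_boot all_order all_algebra.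
From mathcomp Require Import finmap.
From mathcomp Require Import boolp.

Set Implicit Arguments.
Unset Strict Implicit.
Unset Printing Implicit Defensive.

Import Order.TTheory GRing.Theory Num.Theory.

(* All lattice-point coordinates, and all indices into tuples in the
   mathematical text, start at 1; the [k]-th entry of a tuple encoded as a
   sequence [t] is therefore [nth _ t k.-1]. *)
Definition point : Type := (nat * nat)%type.

Definition pt (s : seq point) (m : nat) : point := nth (0, 0) s m.

Definition rect (a b : nat) : seq point :=
  [seq (i, j) | i <- iota 1 a, j <- iota 1 b].

(** * Tuples of osculating paths *)

(* A subset of [1, a] is the strictly increasing sequence of its elements. *)
Definition BP (a b : nat) (al be : seq nat) : Prop :=
  [/\ sorted ltn al && all (fun x => 1 <= x <= a) al,
      sorted ltn be && all (fun y => 1 <= y <= b) be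
    & size al = size be].

Definition step (p q : point) : bool :=
  (q == (p.1, p.2.+1)) || ((q.1.+1 == p.1) && (q.2 == p.2)).

(* [Q_0, ..., Q_L] is the sequence [Q], of length L + 1. *)
Definition Pi (a b x y : nat) (Q : seq point) : Prop :=
  [/\ Q <> [::], pt Q 0 = (a, y), pt Q (size Q).-1 = (x, b) & sorted step Q].

Definition osculating (Q Q' : seq point) : Prop :=
  forall m m' i j : nat,
    m < size Q -> m' < size Q' -> pt Q m = (i, j) -> pt Q' m' = (i, j) ->
    [/\ 0 < m /\ pt Q m.-1 = (i, j.-1),
        m.+1 < size Q /\ pt Q m.+1 = (i.-1, j),
        0 < m' -> pt Q' m'.-1 = (i.+1, j)
      & m'.+1 < size Q' -> pt Q' m'.+1 = (i, j.+1)].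

(* [P_(k+1)] is [nth [::] P k]. *)
Definition OPab (a b : nat) (al be : seq nat) (P : seq (seq point)) : Prop :=
  [/\ size P = size al,
      forall k, k < size al ->
        Pi a b (nth 0 al k) (nth 0 be k) (nth [::] P k)
    & forall k, k.+1 < size al ->
        osculating (nth [::] P k) (nth [::] P k.+1)].

Definition OP (a b : nat) (P : seq (seq point)) : Prop :=
  exists al be : seq nat, BP a b al be /\ OPab a b al be P.

Definition vacancy (P : seq (seq point)) (z : point) : bool :=
  all (fun Q : seq point => z \notin Q) P.

Definition osculation (P : seq (seq point)) (z : point) : bool :=
  1 < count (fun Q : seq point => z \in Q) P.

Definition Z (a b : nat) (P : seq (seq point)) : {fset point} :=
  [fset z in rect a b | vacancy P z || osculation P z]%fset.

(** * Vacancy-osculation sets *)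

Definition VOS (a b : nat) (S : {fset point}) : Prop :=
  exists P, OP a b P /\ Z a b P = S.

Definition VOSabl (a b : nat) (al be : seq nat) (l : nat)
    (S : {fset point}) : Prop :=
  exists P, [/\ OPab a b al be P, Z a b P = S & #|` S|%fset = l].

(* The [P] below is unique, because [Z a b] is injective on [OP a b]. *)
Definition osculations (a b : nat) (S : {fset point}) : {fset point} :=
  [fset z in S | `[< exists P, [/\ OP a b P, Z a b P = S & osculation P z] >]]%fset.

Definition chi (a b : nat) (S : {fset point}) : nat :=
  #|` osculations a b S|%fset.

Definition ordering (T : {fset point}) (s : seq point) : Prop :=
  uniq s /\ [fset z in s]%fset = T.

Definition canonical_ordering (T : {fset point}) (s : seq point) : Prop :=
  ordering T s /\
  forall k m, k < m < size s ->
    (pt s k).1 < (pt s m).1 \/ (pt s k).2 < (pt s m).2.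

Definition progression (a b : nat) (S : {fset point}) (s : seq point) : Prop :=
  ordering S s /\
  forall k, k <= size s -> VOS a b [fset z in take k s]%fset.

(** * Partitions *)

(* A partition is the sequence of its nonzero terms, so that [size la] is the
   number of these and [sumn la] is the size of the partition. *)
Definition is_part (la : seq nat) : bool := sorted geq la && all (leq 1) la.

Definition term (la : seq nat) (i : nat) : nat := nth 0 la i.-1.

Definition conjugate (la : seq nat) : seq nat :=
  [seq count (leq j) la | j <- iota 1 (term la 1)].

Definition Y (la : seq nat) : {fset point} :=
  [fset z in [seq (i, j) | i <- iota 1 (size la), j <- iota 1 (term la i)]]%fset.

(* The Frobenius notation ([ga] | [de]).  The first [size ga] rows are read off
   directly; below them, column k <= size ga ends in row de_k + k, and
   there are no further columns. [frobeniusP] and [is_frobenius_uniq] show that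
   this is the partition characterized by [is_frobenius]. *)
Definition frobenius (ga de : seq nat) : seq nat :=
  [seq term ga i + i | i <- iota 1 (size ga)] ++
  [seq count (fun k => i <= term de k + k) (iota 1 (size ga))
     | i <- iota (size ga).+1 (if ga is [::] then 0
                               else (term de 1).+1 - size ga)].

Definition is_frobenius (ga de la : seq nat) : Prop :=
  [/\ is_part la,
      count (fun i => i <= term la i) (iota 1 (size la)) = size ga
    & forall i, 1 <= i <= size ga ->
        term la i = term ga i + i /\ term (conjugate la) i = term de i + i].

Lemma count_antitone (P : pred nat) n j :
  (forall k, 1 <= k < n -> P k.+1 -> P k) -> 1 <= j <= n ->
  (j <= count P (iota 1 n)) = P j.
Proof.
move=> anti /andP[j1 jn].
have down k m : 1 <= k <= m -> m <= n -> P m -> P k.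
  move=> /andP[k1 /subnKC<-]; elim: (m - k) => [|d IH]; first by rewrite addn0.
  rewrite addnS => le /anti Pk; apply: IH; first exact: ltnW.
  by apply: Pk; rewrite le (leq_trans k1 (leq_addr _ _)).
have -> : iota 1 n = iota 1 j ++ iota j.+1 (n - j).
  by rewrite -[in LHS](subnKC jn) iotaD add1n.
rewrite count_cat; case Pj: (P j).
  have: all P (iota 1 j).
    apply/allP => k; rewrite mem_iota add1n ltnS => kj.
    exact: (down _ _ kj jn Pj).
  by rewrite all_count size_iota => /eqP ->; exact: leq_addr.
have/eqP->: count P (iota j.+1 (n - j)) == 0.
  rewrite -leqn0 leqNgt -has_count; apply/hasPn => k.
  rewrite mem_iota addSn subnKC // => /andP[jk kn]; apply/negP => Pk.
  by move/negP: Pj; apply; apply: (down _ k); rewrite // j1 ltnW.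
rewrite addn0; apply/negbTE; rewrite -ltnNge.
case: j j1 Pj {jn} => // j _ Pj.
have -> : iota 1 j.+1 = iota 1 j ++ [:: j.+1] by rewrite -(addn1 j) iotaD [j + 1]addnC.
rewrite count_cat /= Pj !addn0 ltnS.
by rewrite -{2}(size_iota 1 j) count_size.
Qed.

Lemma count_leq_iota h m n : m <= h.+1 -> h < m + n ->
  count (fun i => i <= h) (iota m n) = h.+1 - m.
Proof.
elim: n m => [|n IH] m mh hn /=.
  by apply/esym/eqP; rewrite subn_eq0; move: hn; rewrite addn0.
case: (ltnP h m) => [hm|mh'].
  rewrite (eqP (_ : h.+1 - m == 0)) ?subn_eq0 //; apply/eqP.
  rewrite eqn0Ngt -has_count; apply/hasPn => i; rewrite mem_iota -ltnNge.
  by move=> /andP[mi _]; exact: ltn_trans mi.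
by rewrite IH ?addSnnS // subSS subSn.
Qed.

Lemma sorted_gtn_term ga i : sorted gtn ga -> 1 <= i < size ga ->
  term ga i.+1 < term ga i.
Proof.
move=> /(sortedP 0) gaS; by case: i => [|i] // /andP[_ /gaS].
Qed.

Lemma sorted_geq_term la i j : sorted geq la -> 1 <= i <= j ->
  term la j <= term la i.
Proof.
move=> laS; case: i => // i; case: j => // j; rewrite /term !succnK /= ltnS => ij.
case: (ltnP j (size la)) => [jl|/(nth_default 0)->//].
have geT : transitive geq by move=> ? ? ? h1 h2; apply: leq_trans h2 h1.
by apply: (sorted_leq_nth geT leqnn _ laS); rewrite ?inE // (leq_ltn_trans ij).
Qed.

Lemma count_part la k i : sorted geq la -> 1 <= k -> 1 <= i ->
  (i <= count (leq k) la) = (k <= term la i).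
Proof.
move=> laS k1 i1; case: (leqP i (size la)) => [il|il].
  have -> : count (leq k) la = count (fun i => k <= term la i) (iota 1 (size la)).
    rewrite -{1}[la](mkseq_nth 0) /mkseq count_map (iotaDl 1 0) count_map.
    by apply: eq_count => m.
  apply: count_antitone; last by rewrite i1.
  move=> m /andP[m1 _] /leq_trans; apply; apply: sorted_geq_term => //.
  by rewrite m1 leqnSn.
rewrite /term nth_default; last by case: i i1 il.
rewrite [RHS]leqNgt k1; apply/negbTE; rewrite -ltnNge.
exact: leq_ltn_trans (count_size _ _) il.
Qed.

Lemma term_conjugate la i : sorted geq la -> 1 <= i <= term la 1 ->
  term (conjugate la) i = count (leq i) la.
Proof.
move=> laS /andP[i1 il]; rewrite /conjugate {1}/term.
case: i i1 il => // i _ il.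
by rewrite /= (nth_map 0) ?size_iota // nth_iota // add1n.
Qed.

Lemma eq_part la mu : is_part la -> is_part mu ->
  (forall i, 1 <= i -> term la i = term mu i) -> la = mu.
Proof.
have sz nu : is_part nu -> forall i, (i < size nu) = (0 < nth 0 nu i).
  move=> /andP[_ /allP pos] i; case: ltnP => [il|/(nth_default 0)->//].
  by rewrite (pos _ (mem_nth 0 il)).
move=> laP muP e; apply: (@eq_from_nth _ 0) => [|i _]; last exact: (e i.+1).
have h i : (i < size la) = (i < size mu) by rewrite !sz //; congr leq; exact: (e i.+1).
apply/eqP; rewrite eqn_leq.
have:= h (size la); have := h (size mu); rewrite !ltnn.
by move=> /negbT; rewrite -leqNgt => -> /esym/negbT; rewrite -leqNgt => ->.
Qed.

Lemma is_frobenius_uniq ga de la mu :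
  is_frobenius ga de la -> is_frobenius ga de mu -> la = mu.
Proof.
move=> Fla Fmu; have [laP _ _] := Fla; have [muP _ _] := Fmu.
pose r := size ga.
have low nu : is_frobenius ga de nu -> forall i, r < i ->
    term nu i = count (fun k => i <= term de k + k) (iota 1 r).
  move=> [/andP[nuS _] nuC nuE] i ri.
  have i1 : 0 < i by exact: leq_ltn_trans ri.
  have anti k : 1 <= k -> k < term nu k.+1 -> k <= term nu k.
    move=> k1 /ltnW /leq_trans; apply; apply: sorted_geq_term => //.
    by rewrite k1 leqnSn.
  have ltr : term nu i <= r.
    apply: leq_trans (sorted_geq_term nuS (_ : 1 <= r.+1 <= i)) _ => //.
    rewrite leqNgt; apply/negP => lt.
    have rs : r < size nu.
      by rewrite ltnNge; apply/negP => /(nth_default 0); move: lt; rewrite /term /= => + e; rewrite e.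
    have := @count_antitone (fun i => i <= term nu i) (size nu) r.+1.
    rewrite lt nuC ltnn rs /= => /(_ _ isT) E.
    by suff : false by []; apply: E => k /andP[k1 _]; exact: anti.
  have -> : term nu i = count (leq^~ (term nu i)) (iota 1 r).
    case: (posnP (term nu i)) => [->|t0].
      apply/esym/eqP; rewrite eqn0Ngt -has_count; apply/hasPn => k.
      by rewrite mem_iota -ltnNge => /andP[].
    by rewrite count_leq_iota ?subn1 // add1n ltnS.
  apply: eq_in_count => k; rewrite mem_iota add1n ltnS => kr /=.
  have [k1 kr'] := andP kr; have [e1 <-] := nuE k kr.
  rewrite term_conjugate // ?count_part //.
  rewrite k1 /=; apply: leq_trans (sorted_geq_term nuS (_ : 1 <= 1 <= k)) => //.
  by rewrite e1 leq_addl.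
apply: eq_part => // i i1; case: (leqP i r) => [ir|ri]; last by rewrite !low.
have [_ _ h1] := Fla; have [_ _ h2] := Fmu.
have hi : 1 <= i <= size ga by rewrite i1.
by have [-> _] := h1 i hi; have [-> _] := h2 i hi.
Qed.

Lemma frobeniusP ga de :
  sorted gtn ga -> sorted gtn de -> size ga = size de ->
  is_frobenius ga de (frobenius ga de).
Proof.
move=> gaS deS sz; set la := frobenius ga de; pose r := size ga.
pose h k := term de k + k; pose D := if r is 0 then 0 else h 1.
pose C i := count (fun k => i <= h k) (iota 1 r).
have low nu : sorted gtn nu -> size nu = r ->
    forall k, 1 <= k <= r -> r <= term nu k + k.
  move=> nuS nur k /andP[k1 kr]; rewrite -(subnK kr) leq_add2r.
  move: (r - k) (subnKC kr) => m; elim: m k k1 {kr} => // m IH j j1 e.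
  apply: leq_ltn_trans (sorted_gtn_term nuS _); first by apply: IH; rewrite ?addSnnS.
  by rewrite j1 nur -e addnS ltnS leq_addr.
have mono nu : sorted gtn nu -> size nu = r ->
    forall k, 1 <= k < r -> term nu k.+1 + k.+1 <= term nu k + k.
  move=> nuS nur k kr; rewrite addnS -addSn leq_add2r.
  by apply: sorted_gtn_term; rewrite ?nur.
have hmono k : 1 <= k < r -> h k.+1 <= h k by apply: mono.
have Cge i j : 1 <= j <= r -> (j <= C i) = (i <= h j).
  by apply: count_antitone => k /hmono kr /leq_trans; apply.
have Cr i : C i <= r by rewrite /C -{2}(size_iota 1 r) count_size.
have CD i : D < i -> C i = 0.
  move=> Di; apply/eqP; rewrite -leqn0 leqNgt; apply/negP => C0.
  have r1 : 1 <= 1 <= r by exact: leq_trans C0 (Cr i).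
  move: C0; rewrite Cge // leqNgt; case/negP.
  by move: Di; rewrite /D; case: (r) r1.
have rD : r <= D.
  by rewrite /D; case r0: r => [|m] //; rewrite -r0 low // r0.
have laE : la = [seq term ga i + i | i <- iota 1 r] ++
                [seq C i | i <- iota r.+1 (D - r)].
  rewrite /la /frobenius; congr (_ ++ [seq _ | i <- iota _ _]).
  by rewrite /D /h /r; case: (ga) => //= *; rewrite addn1.
have sla : size la = D by rewrite laE size_cat !size_map !size_iota subnKC.
have tlo i : 1 <= i <= r -> term la i = term ga i + i.
  case: i => // i /= ir; rewrite laE {1}/term nth_cat size_map size_iota ir.
  by rewrite (nth_map 0) ?size_iota // nth_iota // add1n.
have thi i : r < i -> term la i = C i.
  case: i => // i; rewrite ltnS => ri.
  rewrite laE {1}/term nth_cat size_map size_iota ltnNge ri /=.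
  case: (ltnP i D) => iD.
    have lt : i - r < D - r by apply: ltn_sub2r => //; apply: leq_ltn_trans iD.
    by rewrite (nth_map 0) ?size_iota // nth_iota // addSn subnKC.
  by rewrite nth_default ?CD ?ltnS // size_map size_iota leq_sub2r.
have laS : sorted geq la.
  apply/(sortedP 0) => i _; rewrite /geq /=.
  change (term la i.+2 <= term la i.+1).
  case: (ltngtP i.+1 r) => ir.
  - by rewrite (tlo i.+2) ?(tlo i.+1) ?(ltnW ir) //; apply: mono.
  - rewrite !thi ?(ltnW ir) //; first by apply: sub_count => k /ltnW.
    exact: ltnW.
  - have r1 : 1 <= i.+1 <= r by rewrite -ir leqnn.
    rewrite (tlo i.+1) // (thi i.+2); last by rewrite ir.
    exact: leq_trans (Cr _) (low _ gaS erefl _ r1).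
have laP : is_part la.
  rewrite /is_part laS /=; apply/allP => c /(nthP 0)[i]; rewrite sla => iD <-.
  change (1 <= term la i.+1); case: (leqP i.+1 r) => ir.
    by rewrite tlo // addnS.
  have r1 : 1 <= 1 <= r by move: iD; rewrite /D; case: (r).
  by rewrite thi // Cge //; move: iD; rewrite /D; case: (r) r1.
split=> // [|i /andP[i1 ir]].
  rewrite sla -(subnKC rD) iotaD count_cat add1n -/r.
  have /eqP-> : count (fun i => i <= term la i) (iota r.+1 (D - r)) == 0.
    rewrite -leqn0 leqNgt -has_count; apply/hasPn => k.
    rewrite mem_iota => /andP[rk _]; rewrite thi // -ltnNge.
    exact: leq_ltn_trans (Cr _) rk.
  rewrite addn0 -[RHS](size_iota 1); apply/eqP; rewrite -all_count.
  apply/allP => k; rewrite mem_iota add1n ltnS => kr.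
  by rewrite tlo // leq_addl.
have ri : 1 <= i <= r by rewrite i1.
have r1 : 1 <= 1 <= r by exact: leq_trans i1 ir.
have il : 1 <= i <= term la 1.
  by rewrite i1 tlo // (leq_trans ir) // low.
split; first exact: tlo.
rewrite term_conjugate //; apply/eqP.
rewrite eqn_leq -/(h i); apply/andP; split; last first.
  have h1 : 1 <= h i by rewrite (leq_trans i1) ?leq_addl.
  rewrite count_part //; case: (leqP (h i) r) => hr; last by rewrite thi // Cge.
  by rewrite tlo ?h1 // (leq_trans ir) // (leq_trans _ (low _ _ _ _ _)) ?h1.
rewrite leqNgt; apply/negP; rewrite count_part // leqNgt; case/negP.
have rh : r < (h i).+1 by rewrite ltnS; apply: low.
by rewrite thi // ltnNge Cge // -ltnNge.
Qed.

(* Zero terms are removed because of the encoding of partitions. *)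
Definition complement (a b : nat) (la : seq nat) : seq nat :=
  [seq c <- [seq b - term la i | i <- rev (iota 1 a)] | 0 < c].

Definition lambda_ (a b : nat) (al be : seq nat) : seq nat :=
  complement a b (frobenius [seq b - y | y <- be] [seq a - x | x <- al]).

(** * Oscillating tableaux *)

Definition adds_square (la mu : seq nat) : Prop :=
  exists z : point, z \notin Y la /\ Y mu = (z |` Y la)%fset.

Definition differ_by_square (la mu : seq nat) : Prop :=
  adds_square la mu \/ adds_square mu la.

Definition content (z : point) : int := (z.2%:Z - z.1%:Z)%R.

(* When [la] and [mu] differ by a square, this sum has that square as its only
   index. *)
Definition Delta (la mu : seq nat) : int :=
  (\sum_(z <- ((Y la `\` Y mu) `|` (Y mu `\` Y la))%fset) content z)%R.

Definition oscillating_tableau (la : seq nat) (l : nat)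
    (eta : seq (seq nat)) : Prop :=
  [/\ size eta = l.+1,
      all is_part eta,
      nth [::] eta 0 = [::],
      nth [::] eta l = la
    & forall k, 1 <= k <= l ->
        differ_by_square (nth [::] eta k.-1) (nth [::] eta k)].

Definition profile (eta : seq (seq nat)) : seq int :=
  [seq Delta (nth [::] eta k.-1) (nth [::] eta k) | k <- iota 1 (size eta).-1].

Definition deletion (eta : seq (seq nat)) (k : nat) : bool :=
  (1 <= k < size eta) &&
  ((sumn (nth [::] eta k)).+1 == sumn (nth [::] eta k.-1)).

Definition num_deletions (eta : seq (seq nat)) : nat :=
  count (deletion eta) (iota 1 (size eta).-1).

(* Main.v *)
(* Let X(i, j) be the number of paths of P meeting [1, i] x [1, j].  Then X grows
   by 0 or 1 at each unit step to the right or down, and X(i, j) - X(i-1, j-1) is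
   the number of paths through (i, j), so that Z(P) consists of the points where
   this difference is not 1.  Hence Z(P) determines the parities of X, and
   therefore X itself.  The squares of lambda_(a,b,al,be) on a diagonal are its
   first points, and the others are as many as the value of X at its end on the
   bottom or right side of the rectangle.  Adding one point to Z(P) changes the
   parity of just one of these boundary values; as they change by at most one along
   the boundary, they are all unchanged but this one, which changes by one, so that
   one square is added or removed on the diagonal of the new point.  Deletions are
   counted by the sum of the boundary values, which telescopes into the sum of
   X(i, j) - X(i-1, j-1).  When the progression is canonical, X at s_k and at
   s_k - (1, 1) does not change after step k. *)
Require Import Defs.
From mathcomp Require Import all_boot all_order all_algebra.
From mathcomp Require Import finmap zify ring.
From mathcomp Require Import boolp.

Set Implicit Arguments.
Unset Strict Implicit.
Unset Printing Implicit Defensive.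

#[local] Arguments pt : simpl never.

(** * Corner sums of osculating paths *)

Lemma sorted_stepP Q m : sorted step Q -> m.+1 < size Q ->
  pt Q m.+1 = ((pt Q m).1, (pt Q m).2.+1) \/
  (pt Q m.+1).1.+1 = (pt Q m).1 /\ (pt Q m.+1).2 = (pt Q m).2.
Proof.
move=> /(sortedP (0, 0)) h /h.
by rewrite -!/(pt _ _) => /orP[/eqP->|/andP[/eqP h1 /eqP h2]]; [left|right].
Qed.

Lemma path_mono Q m n : sorted step Q -> m <= n < size Q ->
  (pt Q n).1 <= (pt Q m).1 /\ (pt Q m).2 <= (pt Q n).2.
Proof.
move=> Qs /andP[/subnKC<-]; elim: (n - m) => [|d IH]; first by rewrite addn0.
rewrite addnS => lt; have [] := IH (ltnW lt).
by case: (sorted_stepP Qs lt) => [->|[]] /=; lia.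
Qed.

(** Each step raises the content, column minus row, by one, so the content of a point fixes its
    index on the path. Both sides are sums to avoid truncated subtraction. *)
Lemma path_content a b x y Q m : Pi a b x y Q -> m < size Q ->
  (pt Q m).2 + a = y + m + (pt Q m).1.
Proof.
move=> [_ h0 _ Qs]; elim: m => [|m IH] lt; first by rewrite h0 /=; lia.
have := IH (ltnW lt).
by case: (sorted_stepP Qs lt) => [->|[]] /=; lia.
Qed.

Lemma path_size a b x y Q : Pi a b x y Q -> a + b + 1 = x + y + size Q.
Proof.
move=> QP; have [Q0 _ hl _] := QP.
have s0 : 0 < size Q by case: Q Q0 {QP hl}.
have := @path_content _ _ _ _ _ (size Q).-1 QP.
by rewrite hl /= prednK // leqnn => /(_ isT); lia.
Qed.

Lemma path_bounds a b x y Q m : Pi a b x y Q -> m < size Q ->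
  x <= (pt Q m).1 <= a /\ y <= (pt Q m).2 <= b.
Proof.
move=> [_ h0 hl Qs] lt.
have [] := @path_mono Q 0 m Qs lt; have [] := @path_mono Q m (size Q).-1 Qs.
  by lia.
by rewrite h0 hl /=; lia.
Qed.

Definition meets (Q : seq point) (i j : nat) : bool :=
  has (fun z => (z.1 <= i) && (z.2 <= j)) Q.

Lemma meetsP Q i j :
  reflect (exists2 m, m < size Q & (pt Q m).1 <= i /\ (pt Q m).2 <= j) (meets Q i j).
Proof.
apply: (iffP (has_nthP (0, 0))) => [[m ms /andP[]]|[m ms [h1 h2]]]; exists m => //.
by rewrite h1 h2.
Qed.

Lemma mem_ptP (Q : seq point) z :
  reflect (exists2 m, m < size Q & pt Q m = z) (z \in Q).
Proof. exact: (nthP (0, 0)). Qed.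

Lemma meets_mono Q i j i' j' : i <= i' -> j <= j' -> meets Q i j -> meets Q i' j'.
Proof. by move=> ii jj; apply: sub_has => z /andP[h1 h2]; apply/andP; lia. Qed.

Lemma meets_bottom a b x y Q j : Pi a b x y Q -> meets Q a j = (y <= j).
Proof.
move=> QP; apply/meetsP/idP => [[m ms [_ h]]|yj].
  by have := path_bounds QP ms; lia.
have [Q0 h0 _ _] := QP; exists 0; first by case: Q Q0 {QP h0}.
by rewrite h0.
Qed.

Lemma meets_right a b x y Q i : Pi a b x y Q -> meets Q i b = (x <= i).
Proof.
move=> QP; apply/meetsP/idP => [[m ms [h _]]|xi].
  by have := path_bounds QP ms; lia.
have [Q0 _ hl _] := QP; exists (size Q).-1; first by case: Q Q0 {QP hl}.
by rewrite hl.
Qed.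

(* A path has exactly one point of each content between those of its ends, and
   it is to the north-west of [(i.+1, j.+1)] as soon as some point of the path is. *)
Lemma mem_path a b x y Q i j : Pi a b x y Q -> i < a -> j < b ->
  ((i.+1, j.+1) \in Q) = meets Q i.+1 j.+1 && ~~ meets Q i j.
Proof.
move=> QP ia jb; have [_ _ _ Qs] := QP; have szQ := path_size QP.
apply/mem_ptP/andP => [[m ms e]|[/meetsP[m ms [h1 h2]] nm]].
  split; first by apply/meetsP; exists m; rewrite // e.
  apply/negP => /meetsP[n ns [h1 h2]].
  case: (leqP m n) => mn.
    by have := @path_mono Q m n Qs; rewrite mn ns e => /(_ isT) /=; lia.
  by have := @path_mono Q n m Qs; rewrite (ltnW mn) ms e => /(_ isT) /=; lia.
have cm := path_content QP ms; have bm := path_bounds QP ms.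
(* By [path_content], this is the index of the point of content [j - i]. *)
pose n := j + a - i - y.
have ns : n < size Q by rewrite /n; lia.
have cn := path_content QP ns; have bn := path_bounds QP ns.
exists n => //; case e : (pt Q n) cn bn => [p q] /= cn bn.
have pi : p <= i.+1.
  case: (leqP m n) => mn.
    by have := @path_mono Q m n Qs; rewrite mn ns e => /(_ isT) /=; lia.
  have := @path_mono Q n m Qs; rewrite (ltnW mn) ms e => /(_ isT) /=.
  by move: cn; rewrite /n; lia.
have [pi'|pi'] : p = i.+1 \/ p <= i by lia.
  by congr (_, _); move: cn; rewrite /n; lia.
by case/meetsP: nm; exists n => //; rewrite e /=; move: cn; rewrite /n; lia.
Qed.

(* Comparing the points of equal content: the first path is weakly north-west
   of the second one at the beginning of the latter, and remains so. *)
Lemma osculating_meets a b x y x' y' Q Q' i j :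
  Pi a b x y Q -> Pi a b x' y' Q' -> x < x' -> y < y' -> osculating Q Q' ->
  meets Q' i j -> meets Q i j.
Proof.
move=> QP QP' xx yy osc /meetsP[m ms [h1 h2]].
have szQ := path_size QP; have szQ' := path_size QP'.
have [_ _ _ Qs] := QP; have [_ _ _ Qs'] := QP'.
(* The shift by [y' - y] pairs each point of [Q'] with the point of [Q] of the same content. *)
have ns k : k < size Q' -> k + (y' - y) < size Q by lia.
suff le : (pt Q (m + (y' - y))).1 <= (pt Q' m).1.
  apply/meetsP; exists (m + (y' - y)); first exact: ns.
  by have := path_content QP (ns _ ms); have := path_content QP' ms; lia.
elim: m ms {h1 h2} => [|m IH] ms.
  have [_ -> _ _] := QP'.
  by have := path_bounds QP (ns _ ms); rewrite /=; lia.
have ms' := ltnW ms; have nm := ns _ ms; rewrite addSn in nm *.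
have ns' := ns _ ms'.
have cm := path_content QP' ms'; have cn := path_content QP ns'.
have [lt|e1] : (pt Q (m + (y' - y))).1 < (pt Q' m).1 \/
               (pt Q (m + (y' - y))).1 = (pt Q' m).1 by have := IH ms'; lia.
  have sn := sorted_stepP Qs nm; have sm := sorted_stepP Qs' ms.
  by case: sn => [->|[? _]]; case: sm => [->|[? _]] /=; lia.
(* Points with equal row and content coincide; osculation then sends [Q] up and [Q'] to the
   right. *)
have e : pt Q (m + (y' - y)) = pt Q' m.
  by case: (pt Q _) e1 cn => ? ?; case: (pt Q' m) cm => ? ? /= *; congr (_, _); lia.
case e' : (pt Q' m) e => [p q] e.
have [_ [_ ->] _ /(_ ms)->] := osc _ _ _ _ ns' ms' e e'.
by rewrite /= leq_pred.
Qed.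

Definition crossings (P : seq (seq point)) (i j : nat) : nat :=
  count (fun Q => meets Q i j) P.

Section OsculatingTuple.

Variables (a b : nat) (al be : seq nat) (P : seq (seq point)).
Hypotheses (BPab : BP a b al be) (PP : OPab a b al be P).

Lemma crossings_al_be k : k < size P ->
  Pi a b (nth 0 al k) (nth 0 be k) (nth [::] P k) /\
  (1 <= nth 0 al k <= a /\ 1 <= nth 0 be k <= b).
Proof.
have [szP hP _] := PP; have [/andP[_ /allP ha] /andP[_ /allP hb] sz] := BPab.
rewrite szP => kP; split; first exact: hP.
by split; [apply: ha|apply: hb]; rewrite mem_nth // -sz.
Qed.

(** By [osculating_meets], the paths meeting a corner rectangle form an initial segment of [P], so
    their number tells which they are. *)
Lemma meets_crossings k i j : k < size P ->
  meets (nth [::] P k) i j = (k < crossings P i j).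
Proof.
move=> kP; have [szP hP hosc] := PP; have [/andP[sa _] /andP[sb _] sz] := BPab.
have -> : crossings P i j =
    count (fun n => meets (nth [::] P n.-1) i j) (iota 1 (size P)).
  rewrite /crossings -{1}[P](mkseq_nth [::]) /mkseq count_map (iotaDl 1 0) count_map.
  exact: eq_count.
rewrite (@count_antitone _ (size P) k.+1) // => n /andP[n1 nP].
case: n n1 nP => // n _ nP /=; rewrite szP in nP.
have n' := ltnW nP.
apply: (osculating_meets (hP _ n') (hP _ nP) _ _ (hosc _ nP)).
  exact: (sortedP 0 sa).
by apply: (sortedP 0 sb); rewrite -sz.
Qed.

Lemma crossings_size i j : crossings P i j <= size P.
Proof. exact: count_size. Qed.

Lemma crossings_row0 j : crossings P 0 j = 0.
Proof.
case e : (crossings P 0 j) => [//|n].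
have P0 : 0 < size P by have := crossings_size 0 j; lia.
have [QP bnd] := crossings_al_be P0.
have := meets_crossings 0 j P0; rewrite e => /meetsP[m ms].
by have := path_bounds QP ms; lia.
Qed.

Lemma crossings_col0 i : crossings P i 0 = 0.
Proof.
case e : (crossings P i 0) => [//|n].
have P0 : 0 < size P by have := crossings_size i 0; lia.
have [QP bnd] := crossings_al_be P0.
have := meets_crossings i 0 P0; rewrite e => /meetsP[m ms].
by have := path_bounds QP ms; lia.
Qed.

Lemma crossings_mono i j i' j' : i <= i' -> j <= j' ->
  crossings P i j <= crossings P i' j'.
Proof. by move=> ii jj; apply: sub_count => Q; apply: meets_mono. Qed.

(* Of the paths counted by exactly one of the two crossing numbers, two
   consecutive ones would meet at [(i.+1, j.+1)]. *)
Lemma crossings_right i j : i <= a -> j < b ->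
  crossings P i j.+1 <= (crossings P i j).+1.
Proof.
case: i => [|i] ia jb; first by rewrite crossings_row0.
rewrite leqNgt; apply/negP; set k := crossings P i.+1 j => lt.
have k1 : k.+1 < size P by apply: leq_trans lt (crossings_size _ _).
have k0 := ltnW k1.
have [QP _] := crossings_al_be k0; have [QP' _] := crossings_al_be k1.
have nm n : n < size P -> k <= n -> n <= k.+1 -> (i.+1, j.+1) \in nth [::] P n.
  move=> nP kn nk; have [RP _] := crossings_al_be nP.
  rewrite (mem_path RP) // !meets_crossings // (leq_trans _ lt) //= -leqNgt.
  by apply: leq_trans (crossings_mono (leqnSn i) (leqnn j)) _.
have /mem_ptP[m ms e] := nm k k0 (leqnn _) (leqnSn _).
have /mem_ptP[m' ms' e'] := nm _ k1 (leqnSn _) (leqnn _).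
have [szP _ hosc] := PP; rewrite szP in k1.
(* The upper path enters the common point from the left, hence already meets the smaller
   rectangle. *)
have [[m0 h] _ _ _] := hosc _ k1 _ _ _ _ ms ms' e e'.
have : meets (nth [::] P k) i.+1 j.
  by apply/meetsP; exists m.-1; [lia|rewrite h].
by rewrite meets_crossings // ltnn.
Qed.

Lemma crossings_down i j : i < a -> j <= b ->
  crossings P i.+1 j <= (crossings P i j).+1.
Proof.
case: j => [|j] ia jb; first by rewrite crossings_col0.
rewrite leqNgt; apply/negP; set k := crossings P i j.+1 => lt.
have k1 : k.+1 < size P by apply: leq_trans lt (crossings_size _ _).
have k0 := ltnW k1.
have nm n : n < size P -> k <= n -> n <= k.+1 -> (i.+1, j.+1) \in nth [::] P n.
  move=> nP kn nk; have [RP _] := crossings_al_be nP.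
  rewrite (mem_path RP) // !meets_crossings // (leq_trans _ lt) //= -leqNgt.
  by apply: leq_trans (crossings_mono (leqnn i) (leqnSn j)) _.
have /mem_ptP[m ms e] := nm k k0 (leqnn _) (leqnSn _).
have /mem_ptP[m' ms' e'] := nm _ k1 (leqnSn _) (leqnn _).
have [szP _ hosc] := PP; rewrite szP in k1.
(* Here the upper path leaves the common point upwards, into the smaller rectangle. *)
have [_ [m0 h] _ _] := hosc _ k1 _ _ _ _ ms ms' e e'.
have : meets (nth [::] P k) i j.+1.
  by apply/meetsP; exists m.+1; [lia|rewrite h].
by rewrite meets_crossings // ltnn.
Qed.

(** By [mem_path], the paths gained between the two rectangles are those through [(i.+1, j.+1)]. *)
Lemma crossings_diag i j : i < a -> j < b ->
  crossings P i.+1 j.+1 =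
  crossings P i j + count (fun Q : seq point => (i.+1, j.+1) \in Q) P.
Proof.
move=> ia jb.
have -> : count (fun Q : seq point => (i.+1, j.+1) \in Q) P =
          count (fun Q => meets Q i.+1 j.+1 && ~~ meets Q i j) P.
  apply: eq_in_count => Q /(nthP [::])[k kP <-].
  by have [QP _] := crossings_al_be kP; exact: mem_path QP ia jb.
rewrite /crossings; elim: (P) => //= Q P' ->.
have := @meets_mono Q i j i.+1 j.+1 (leqnSn _) (leqnSn _).
by case: (meets Q i j) => [->|_] //; rewrite andbT; lia.
Qed.

Lemma crossings_bottom j : crossings P a j = count (leq^~ j) be.
Proof.
have [szP hP _] := PP; have [_ _ sz] := BPab.
rewrite /crossings -[P](mkseq_nth [::]) -[be](mkseq_nth 0) /mkseq !count_map.
rewrite szP -sz; apply: eq_in_count => k; rewrite mem_iota add0n => /andP[_ kP].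
exact: meets_bottom (hP _ kP).
Qed.

Lemma crossings_last i : crossings P i b = count (leq^~ i) al.
Proof.
have [szP hP _] := PP.
rewrite /crossings -[P](mkseq_nth [::]) -[al](mkseq_nth 0) /mkseq !count_map.
rewrite szP; apply: eq_in_count => k; rewrite mem_iota add0n => /andP[_ kP].
exact: meets_right (hP _ kP).
Qed.

End OsculatingTuple.

(** * The shape of a boundary *)

Lemma mem_Y la i j : ((i, j) \in Y la) = [&& 1 <= i, 1 <= j & j <= term la i].
Proof.
rewrite inE /=; apply/allpairsPdep/and3P => [[p [q []]]|[i1 j1 jl]].
  by rewrite !mem_iota => ? ? [-> ->]; split; lia.
exists i, j; rewrite !mem_iota; split=> //; last lia.
rewrite i1 /= add1n ltnS leqNgt; apply/negP => il.
by move: jl; rewrite /term nth_default; lia.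
Qed.

Lemma eq_part_Y la mu : is_part la -> is_part mu -> Y la = Y mu -> la = mu.
Proof.
move=> lp mp /fsetP e; apply: eq_part => // i i1; apply/eqP.
have h j : 1 <= j -> (j <= term la i) = (j <= term mu i).
  by move=> j1; have := e (i, j); rewrite !mem_Y i1 j1.
have h1 := h (term la i); have h2 := h (term mu i); lia.
Qed.

Lemma sumn_Y la : sumn la = #|` Y la|%fset.
Proof.
rewrite /Y card_fseq undup_id; last first.
  apply: allpairs_uniq_dep => [|? _|]; try exact: iota_uniq.
  by move=> [? ?] [? ?] _ _ /= [-> ->].
rewrite size_allpairs_dep; congr sumn.
rewrite -{1}[la](mkseq_nth 0) /mkseq (iotaDl 1 0) -map_comp.
by apply: eq_map => i; rewrite /= size_iota.
Qed.

(** For [k = 0] every entry counts, hence the separate bound by [size s]. *)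
Lemma leq_count_geq s k i : sorted geq s -> 1 <= i ->
  (i <= count (leq k) s) = (i <= size s) && (k <= term s i).
Proof.
move=> ss i1; case: k => [|k]; first by rewrite count_predT andbT.
rewrite count_part //; case: (leqP i (size s)) => //= il.
by rewrite /term nth_default; lia.
Qed.

(** On or above the main diagonal, row [i] reaches column [j] when the [i]-th entry of [ga] is at
    least [j - i]; as [ga] decreases, this says that [i] entries are that large. Below the diagonal,
    columns and [de] take over. *)
Lemma term_frobenius ga de i j : sorted gtn ga -> sorted gtn de ->
  size ga = size de -> 1 <= i -> 1 <= j ->
  (j <= term (frobenius ga de) i) =
  if i <= j then i <= count (leq (j - i)) ga else j <= count (leq (i - j)) de.
Proof.
move=> gaS deS sz i1 j1; have [muP muC muE] := frobeniusP gaS deS sz.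
move: (frobenius ga de) muP muC muE => mu /andP[muS _] muC muE.
have gtS s : sorted gtn s -> sorted geq s.
  by apply: sub_sorted => u v; exact: ltnW.
(* The diagonal squares are exactly the first [size ga] ones, which settles the squares whose
   smaller coordinate exceeds that rank. *)
have rank k : 1 <= k -> (k <= size ga) = (k <= term mu k).
  move=> k1; rewrite -muC; case: (leqP k (size mu)) => kmu.
    rewrite (@count_antitone (fun i => i <= term mu i) (size mu) k) ?k1 // => m ? h.
    by have := @sorted_geq_term mu m m.+1 muS; lia.
  rewrite {2}/term nth_default; last by lia.
  by have := count_size (fun i => i <= term mu i) (iota 1 (size mu)); rewrite size_iota; lia.
case: (leqP i j) => ij; rewrite leq_count_geq ?gtS //.
  case: (leqP i (size ga)) => ir /=.
    by have [|-> _] := muE i; lia.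
  by have := rank i i1; lia.
rewrite -sz; case: (leqP j (size ga)) => jr /=.
  have [e1 e2] : term mu j = term ga j + j /\ term (conjugate mu) j = term de j + j.
    by apply: muE; rewrite j1.
  have h1 := @sorted_geq_term mu 1 j muS.
  rewrite -count_part // -term_conjugate ?e2 //; last by lia.
  by lia.
by have := rank j j1; have := @sorted_geq_term mu j i muS; lia.
Qed.

(** The zeros are at the end of [s], so removing them only trades them for the default value. *)
Lemma nth_filter_pos s k : sorted geq s -> nth 0 [seq c <- s | 0 < c] k = nth 0 s k.
Proof.
elim: s k => //= c s IH k cs; have {}IH n := IH n (path_sorted cs).
case: c cs => [|c] cs; last by case: k => //= k; rewrite IH.
rewrite /= IH; have geT : transitive geq by move=> ? ? ? /= *; lia.
have /allP z := order_path_min geT cs.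
have nz n : nth 0 s n = 0.
  case: (ltnP n (size s)) => ns; last by rewrite nth_default.
  by have := z _ (mem_nth 0 ns); rewrite /=; lia.
by rewrite nz; case: k => //= k; rewrite nz.
Qed.

Lemma complement_part a b mu : sorted geq mu -> is_part (complement a b mu) /\
  forall i, 1 <= i ->
    term (complement a b mu) i = if i <= a then b - term mu (a.+1 - i) else 0.
Proof.
move=> muS; set s := [seq b - term mu i | i <- rev (iota 1 a)].
have ns k : k < a -> nth 0 s k = b - term mu (a - k).
  move=> ka; rewrite (nth_map 0) ?size_rev ?size_iota //.
  rewrite nth_rev ?size_iota // nth_iota; last by lia.
  by congr (b - term mu _); lia.
have ss : sorted geq s.
  apply/(sortedP 0) => k; rewrite size_map size_rev size_iota => ka /=.
  rewrite !ns; [|lia|lia].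
  by have := @sorted_geq_term mu (a - k.+1) (a - k) muS; lia.
have geT : transitive geq by move=> ? ? ? /= *; lia.
split; first by rewrite /is_part sorted_filter //=; exact: filter_all.
move=> i i1; rewrite /term nth_filter_pos //; case: leqP => ia.
  by rewrite ns; [congr (b - nth 0 mu _.-1)|]; lia.
by rewrite nth_default // size_map size_rev size_iota; lia.
Qed.

(* The walk from the bottom-left to the top-right corner along the bottom and
   right sides of [0, a] x [0, b]; its [t]-th point has content [t - a]. *)
Definition boundary (a b : nat) (X : nat -> nat -> nat) (t : nat) : nat :=
  X (minn a (a + b - t)) (minn b t).

Lemma sorted_map_subn n s : sorted ltn s -> all (geq n) s ->
  sorted gtn [seq n - x | x <- s].
Proof.
move=> /(sortedP 0) ss /allP sn; apply/(sortedP 0) => k; rewrite size_map => ks /=.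
have := ss _ ks; have := sn _ (mem_nth 0 ks).
by rewrite !(nth_map 0) ?(ltnW ks) //=; lia.
Qed.

Lemma count_map_subn n k s : all (geq n) s -> k <= n ->
  count (leq k) [seq n - x | x <- s] = count (leq^~ (n - k)) s.
Proof.
move=> /allP sn kn; rewrite count_map; apply: eq_in_count => x /sn /=; lia.
Qed.

Section Shape.

Variables (a b : nat) (al be : seq nat).
Hypothesis BPab : BP a b al be.

Let al_le : all (geq a) al.
Proof. by have [/andP[_ h] _ _] := BPab; apply: sub_all h => x /andP[]. Qed.

Let be_le : all (geq b) be.
Proof. by have [_ /andP[_ h] _] := BPab; apply: sub_all h => x /andP[]. Qed.

Let al_sorted : sorted gtn [seq a - x | x <- al].
Proof. by have [/andP[h _] _ _] := BPab; apply: sorted_map_subn. Qed.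

Let be_sorted : sorted gtn [seq b - y | y <- be].
Proof. by have [_ /andP[h _] _] := BPab; apply: sorted_map_subn. Qed.

Let size_be_al : size [seq b - y | y <- be] = size [seq a - x | x <- al].
Proof. by have [_ _ h] := BPab; rewrite !size_map h. Qed.

Let mu_sorted : sorted geq (frobenius [seq b - y | y <- be] [seq a - x | x <- al]).
Proof. by have [/andP[]] := frobeniusP be_sorted al_sorted size_be_al. Qed.

Lemma lambda_part : is_part (lambda_ a b al be).
Proof. by have [] := complement_part a b mu_sorted. Qed.

(** Complementation turns [(i, j)] into [(a.+1 - i, b.+1 - j)] and negates membership. The count in
    [term_frobenius] then becomes the boundary value at the end of the diagonal of [(i, j)], which
    is [minn (a - i) (b - j)] steps away. *)
Lemma mem_Y_lambda X i j :
  (forall q, X a q = count (leq^~ q) be) -> (forall p, X p b = count (leq^~ p) al) ->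
  ((i, j) \in Y (lambda_ a b al be)) =
  [&& 1 <= i <= a, 1 <= j <= b & boundary a b X (j + a - i) <= minn (a - i) (b - j)].
Proof.
move=> Xbot Xlast; rewrite mem_Y.
case: (posnP i) => [->//|i1]; case: (posnP j) => [->|j1]; rewrite ?andbF //.
have [_ ->//] := complement_part a b mu_sorted.
case: (leqP i a) => ia /=; last by rewrite leqNgt j1.
case: (leqP j b) => jb /=; last by lia.
have := @term_frobenius _ _ (a.+1 - i) (b.+1 - j) be_sorted al_sorted size_be_al.
have -> : (j <= b - term (frobenius [seq b - y | y <- be] [seq a - x | x <- al]) (a.+1 - i))
   = ~~ (b.+1 - j <= term (frobenius [seq b - y | y <- be] [seq a - x | x <- al]) (a.+1 - i)).
  lia.
move=> ->; [|lia|lia].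
(* The two cases are diagonals ending on the bottom side and on the right side. *)
rewrite /boundary; case: leqP => ij.
  rewrite count_map_subn //; last by lia.
  have -> : minn a (a + b - (j + a - i)) = a by lia.
  rewrite Xbot; have -> : minn b (j + a - i) = b - (b.+1 - j - (a.+1 - i)) by lia.
  by lia.
rewrite count_map_subn //; last by lia.
have -> : minn b (j + a - i) = b by lia.
rewrite Xlast; have -> : minn a (a + b - (j + a - i)) = a - (a.+1 - i - (b.+1 - j)) by lia.
by lia.
Qed.

End Shape.

(** * Corner sums *)

(** An axiomatic form of the crossing numbers. The unit steps bound each diagonal increment by two,
    and [S] records where it is 0 or 2. *)
Record corner_sum (a b : nat) (S : {fset point}) (X : nat -> nat -> nat) : Prop :=
  CornerSum {
    corner_row0 : forall j, X 0 j = 0;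
    corner_col0 : forall i, X i 0 = 0;
    corner_right : forall i j, i <= a -> j < b -> X i j <= X i j.+1 <= (X i j).+1;
    corner_down : forall i j, i < a -> j <= b -> X i j <= X i.+1 j <= (X i j).+1;
    corner_mem : forall i j, i < a -> j < b ->
      ((i.+1, j.+1) \in S) = (X i.+1 j.+1 != (X i j).+1) }.

Lemma corner_leq a b S X i j : corner_sum a b S X -> i <= a -> j <= b ->
  X i j <= minn i j.
Proof.
move=> XS ia jb; rewrite leq_min; apply/andP; split.
  elim: i ia => [|i IH] ia; first by rewrite (corner_row0 XS).
  by have := corner_down XS ia jb; have := IH (ltnW ia); lia.
elim: j jb => [|j IH] jb; first by rewrite (corner_col0 XS).
by have := corner_right XS ia jb; have := IH (ltnW jb); lia.
Qed.

(** Given [X i j] and [X i.+1 j], there are two consecutive candidates for [X i.+1 j.+1], exactly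
    one of which is [(X i j).+1]; membership in [S] selects between them. Only points north-west of
    [(i, j)] matter, which canonical orderings exploit. *)
Lemma eq_corner_sum a b S X S' X' i j :
  corner_sum a b S X -> corner_sum a b S' X' -> i <= a -> j <= b ->
  (forall p q, p < i -> q < j -> ((p.+1, q.+1) \in S) = ((p.+1, q.+1) \in S')) ->
  X i j = X' i j.
Proof.
move=> XS XS'; elim: i j => [|i IHi] j.
  by rewrite (corner_row0 XS) (corner_row0 XS').
elim: j => [|j IHj] ia jb e; first by rewrite (corner_col0 XS) (corner_col0 XS').
have e1 : X i j = X' i j by apply: IHi; try lia; move=> p q *; apply: e; lia.
have e2 : X i.+1 j = X' i.+1 j by apply: IHj; try lia; move=> p q *; apply: e; lia.
have := corner_right XS ia jb; have := corner_right XS' ia jb.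
have := corner_down XS ia (ltnW jb); have := corner_down XS' ia (ltnW jb).
have := e i j (ltnSn i) (ltnSn j).
by rewrite (corner_mem XS) // (corner_mem XS') //; lia.
Qed.

Definition toggles (p q : nat) (S S' : {fset point}) : Prop :=
  forall i j, ((i, j) \in S') = ((i, j) \in S) (+) ((i == p) && (j == q)).

Section Toggle.

Variables (a b : nat) (S S' : {fset point}) (X X' : nat -> nat -> nat) (p q : nat).
Hypotheses (XS : corner_sum a b S X) (XS' : corner_sum a b S' X').
Hypotheses (pa : 1 <= p <= a) (qb : 1 <= q <= b) (SS' : toggles p q S S').

(** A point is in [S] when its diagonal increment is even, so toggling [(p, q)] flips the parities
    from there on along its diagonal. *)
Lemma odd_toggle i j : i <= a -> j <= b ->
  odd (X' i j) = odd (X i j) (+) ((p <= i) && (q + i == j + p)).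
Proof.
elim: i j => [|i IH] [|j] ia jb; rewrite ?(corner_row0 XS) ?(corner_row0 XS');
  rewrite ?(corner_col0 XS) ?(corner_col0 XS') /=; try lia.
have := IH j (ltnW ia) (ltnW jb).
have := SS' i.+1 j.+1.
rewrite (corner_mem XS) // (corner_mem XS') //.
have := corner_right XS ia jb; have := corner_right XS' ia jb.
have := corner_down XS ia (ltnW jb); have := corner_down XS' ia (ltnW jb).
have -> : (p <= i.+1) && (q + i.+1 == j.+1 + p) =
  ((p <= i) && (q + i == j + p)) (+) ((i.+1 == p) && (j.+1 == q)) by lia.
case: ((p <= i) && _); case: ((i.+1 == p) && _); lia.
Qed.

(** The first [b] steps go right along the bottom; the others go up the right side, where the values
    decrease. *)
Lemma boundary_step Sa Y t : corner_sum a b Sa Y -> t < a + b ->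
  if t < b then boundary a b Y t <= boundary a b Y t.+1 <= (boundary a b Y t).+1
  else boundary a b Y t.+1 <= boundary a b Y t <= (boundary a b Y t.+1).+1.
Proof.
move=> YS tab; rewrite /boundary; case: ifP => tb.
  have -> : minn a (a + b - t) = a by lia.
  have -> : minn a (a + b - t.+1) = a by lia.
  have -> : minn b t = t by lia.
  have -> : minn b t.+1 = t.+1 by lia.
  exact: (corner_right YS).
have -> : minn b t = b by lia.
have -> : minn b t.+1 = b by lia.
have -> : minn a (a + b - t) = (minn a (a + b - t.+1)).+1 by lia.
by apply: (corner_down YS); lia.
Qed.

(** The diagonal of [(p, q)] meets the walk only at time [q + a - p]. *)
Lemma odd_boundary t : t <= a + b ->
  odd (boundary a b X' t) = odd (boundary a b X t) (+) (t == q + a - p).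
Proof. by move=> tab; rewrite odd_toggle; [congr addb|..]; lia. Qed.

(* Both walks vanish at the two ends and move in a common direction by at most
   one at each step, so they agree as far as their parities do. *)
Lemma eq_boundary t : t <= a + b -> t != q + a - p ->
  boundary a b X' t = boundary a b X t.
Proof.
move=> tab tz; have [lt|gt] : t < q + a - p \/ q + a - p < t by lia.
  elim: t tab tz lt => [|t IH] tab tz lt.
    by rewrite /boundary minn0 (corner_col0 XS) (corner_col0 XS').
  have := boundary_step XS tab; have := boundary_step XS' tab.
  have := odd_boundary tab; have := IH (ltnW tab); case: ifP; lia.
(* Past the diagonal of [(p, q)] the induction runs backwards from the top-right corner, with
   [u = a + b - t]. *)
rewrite -(subKn tab); move: (a + b - t) (leq_subr t (a + b)) (subKn tab) => u uab e.
rewrite -{}e in gt; elim: u uab gt => [|u IH] uab gt.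
  by rewrite /boundary subn0 subnn minn0 (corner_row0 XS) (corner_row0 XS').
have tab' : a + b - u.+1 < a + b by lia.
have := boundary_step XS tab'; have := boundary_step XS' tab'.
have := odd_boundary (ltnW tab'); have := IH (ltnW uab).
have -> : (a + b - u.+1).+1 = a + b - u by lia.
case: ifP; lia.
Qed.

(** The walks agree one step earlier, move by at most one in the same direction, and differ in
    parity here. *)
Lemma boundary_toggle : let t := q + a - p in
  boundary a b X' t = (boundary a b X t).+1 \/ boundary a b X t = (boundary a b X' t).+1.
Proof.
move=> t; have tab : t.-1 < a + b by rewrite /t; lia.
have := boundary_step XS tab; have := boundary_step XS' tab.
have -> : t.-1.+1 = t by rewrite /t; lia.
have := @odd_boundary t; have := @eq_boundary t.-1; rewrite -/t eqxx.
by case: ifP; rewrite /t; lia.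
Qed.

End Toggle.

(** * Counting osculations *)

(** Membership in [S] does not separate increments 0 and 2; this counts the latter, which for
    crossing numbers are the osculations. *)
Definition excesses (a b : nat) (X : nat -> nat -> nat) : nat :=
  \sum_(i < a) \sum_(j < b) (X i.+1 j.+1 == (X i j).+2).

Lemma card_rect (a b : nat) (A : {fset point}) : {subset A <= rect a b} ->
  #|` A|%fset = \sum_(i < a) \sum_(j < b) ((i.+1, j.+1) \in A).
Proof.
move=> Ar; have u : uniq (rect a b).
  by apply: allpairs_uniq; rewrite ?iota_uniq // => -[? ?] [? ?].
have -> : #|` A|%fset = count (mem A) (rect a b).
  rewrite -size_filter; apply: perm_size; apply: uniq_perm => [||z].
  - exact: fset_uniq.
  - exact: filter_uniq.
  by rewrite mem_filter /=; case e : (z \in A); rewrite // (Ar _ e).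
rewrite -sum1_count big_mkcond /= /rect big_allpairs.
rewrite (iotaDl 1 0 a) big_map -{1}[a]subn0 big_mkord; apply: eq_bigr => i _.
rewrite (iotaDl 1 0 b) big_map -{1}[b]subn0 big_mkord; apply: eq_bigr => j _.
by rewrite !add1n; case: (_ \in _).
Qed.

Lemma excesses0 a b X : corner_sum a b fset0 X -> excesses a b X = 0.
Proof.
move=> X0; rewrite /excesses big1 // => i _; rewrite big1 // => j _.
by have := corner_mem X0 (ltn_ord i) (ltn_ord j); rewrite in_fset0; lia.
Qed.

(** The diagonal increments telescope: each diagonal starts at value 0 and leaves only its value at
    the end. *)
Lemma sum_boundary a b S X : corner_sum a b S X ->
  \sum_(t < (a + b).+1) boundary a b X t + \sum_(i < a) \sum_(j < b) X i j =
  \sum_(i < a) \sum_(j < b) X i.+1 j.+1.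
Proof.
move=> XS.
have -> : \sum_(t < (a + b).+1) boundary a b X t =
          \sum_(j < b) X a j + \sum_(i < a) X i.+1 b.
  have -> : (a + b).+1 = b + a.+1 by lia.
  rewrite big_split_ord; congr (_ + _).
    apply: eq_bigr => t _; rewrite /boundary /=; have := ltn_ord t.
    by move=> tb; congr (X _ _); lia.
  rewrite big_ord_recr /= [X in _ + X](_ : _ = 0); last first.
    by rewrite -(corner_row0 XS b) /boundary; congr (X _ _); lia.
  rewrite addn0 (reindex_inj rev_ord_inj) /=; apply: eq_bigr => i _.
  by have := ltn_ord i; rewrite /boundary => ia; congr (X _ _); lia.
have row i : \sum_(j < b) X i j.+1 = \sum_(j < b) X i j + X i b.
  transitivity (\sum_(j < b.+1) X i j); last by rewrite big_ord_recr.
  by rewrite big_ord_recl (corner_col0 XS).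
elim: {+}a => [|n IH]; last first.
  rewrite !big_ord_recr /= row -IH.
  by ring.
by rewrite !big_ord0 !addn0 big1 // => j _; rewrite (corner_row0 XS).
Qed.

(** At each point, the increment plus the indicator of [S] is 1, or 3 when the increment is 2. *)
Lemma sum_boundary_card a b S X : corner_sum a b S X -> {subset S <= rect a b} ->
  \sum_(t < (a + b).+1) boundary a b X t + #|` S|%fset = a * b + (excesses a b X).*2.
Proof.
move=> XS /card_rect ->; have := sum_boundary XS.
rewrite /excesses -mul2n.
suff : \sum_(i < a) \sum_(j < b) X i.+1 j.+1 +
       \sum_(i < a) \sum_(j < b) ((i.+1, j.+1) \in S) =
       \sum_(i < a) \sum_(j < b) X i j + a * b +
       2 * \sum_(i < a) \sum_(j < b) (X i.+1 j.+1 == (X i j).+2).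
  by lia.
have -> : a * b = \sum_(i < a) \sum_(j < b) 1.
  by under eq_bigr do rewrite sum1_card card_ord; rewrite sum_nat_const card_ord.
rewrite big_distrr -!big_split /=; apply: eq_bigr => i _.
rewrite big_distrr -!big_split /=; apply: eq_bigr => j _.
rewrite (corner_mem XS) //.
have := corner_right XS (ltn_ord i) (ltn_ord j).
have := corner_down XS (ltn_ord i) (ltnW (ltn_ord j)).
by case: eqP; case: eqP => /=; lia.
Qed.

(** * Vacancy-osculation sets *)

Lemma mem_rect a b i j : ((i, j) \in rect a b) = (1 <= i <= a) && (1 <= j <= b).
Proof.
apply/allpairsP/idP => [[[p q] /=]|h].
  by rewrite !mem_iota => -[? ? [-> ->]]; lia.
by exists (i, j); rewrite /= !mem_iota; split=> //; lia.
Qed.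

Lemma sub_Z_rect a b P : {subset Z a b P <= rect a b}.
Proof. by move=> z; rewrite !inE => /andP[]. Qed.

Section Crossings.

Variables (a b : nat) (al be : seq nat) (P : seq (seq point)).
Hypotheses (BPab : BP a b al be) (PP : OPab a b al be P).

Lemma corner_sum_crossings : corner_sum a b (Z a b P) (crossings P).
Proof.
split=> [j|i|i j ia jb|i j ia jb|i j ia jb].
- exact: (crossings_row0 BPab PP).
- exact: (crossings_col0 BPab PP).
- by rewrite crossings_mono //= (crossings_right BPab PP).
- by rewrite crossings_mono //= (crossings_down BPab PP).
rewrite (crossings_diag BPab PP) // !inE mem_rect ia jb /= /vacancy /osculation.
rewrite [all _ _](all_predC (fun Q : seq point => (i.+1, j.+1) \in Q)) has_count.
by set c := count _ P; lia.
Qed.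

Lemma osculation_crossings i j : i < a -> j < b ->
  osculation P (i.+1, j.+1) = (crossings P i.+1 j.+1 == (crossings P i j).+2).
Proof.
move=> ia jb; have XZ := corner_sum_crossings.
have := corner_right XZ (ltnW ia) jb; have := corner_down XZ ia jb.
by rewrite (crossings_diag BPab PP) // /osculation; set c := count _ P; lia.
Qed.

End Crossings.

Section Determined.

Variables (a b : nat) (al be : seq nat) (P : seq (seq point)).
Hypotheses (BPab : BP a b al be) (PP : OPab a b al be P).

(** This replaces the injectivity of [Z]: what is recovered is the crossing numbers instead of the
    tuple. *)
Lemma eq_crossings al' be' P' i j : BP a b al' be' -> OPab a b al' be' P' ->
  Z a b P' = Z a b P -> i <= a -> j <= b -> crossings P' i j = crossings P i j.
Proof.
move=> BPab' PP' eqZ ia jb.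
apply: (eq_corner_sum (corner_sum_crossings BPab' PP') (corner_sum_crossings BPab PP) ia jb).
by rewrite eqZ.
Qed.

Lemma mem_osculations i j : i < a -> j < b ->
  ((i.+1, j.+1) \in osculations a b (Z a b P)) =
  (crossings P i.+1 j.+1 == (crossings P i j).+2).
Proof.
move=> ia jb; rewrite -(osculation_crossings BPab PP) //.
apply/idP/idP => [|o].
  rewrite in_fset /= => /andP[_ /asboolP[P' [[al' [be' [BPab' PP']]] eqZ]]].
  rewrite (osculation_crossings BPab' PP') // (osculation_crossings BPab PP) //.
  by rewrite !(eq_crossings BPab' PP' eqZ) // ltnW.
rewrite in_fset /=; apply/andP; split.
  by rewrite !inE mem_rect ia jb o orbT.
by apply/asboolP; exists P; split=> //; exists al, be.
Qed.

Lemma chi_excesses : chi a b (Z a b P) = excesses a b (crossings P).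
Proof.
rewrite /chi (@card_rect a b) => [|z]; last first.
  by rewrite in_fset => /andP[/sub_Z_rect].
by apply: eq_bigr => i _; apply: eq_bigr => j _; rewrite mem_osculations.
Qed.

Lemma mem_Y_shape i j :
  ((i, j) \in Y (lambda_ a b al be)) =
  [&& 1 <= i <= a, 1 <= j <= b &
      boundary a b (crossings P) (j + a - i) <= minn (a - i) (b - j)].
Proof.
apply: mem_Y_lambda => // k; first exact: (crossings_bottom BPab PP).
exact: (crossings_last PP).
Qed.

End Determined.

(** The shape depends only on the boundary values, hence only on the vacancy-osculation set. *)
Lemma eq_lambda a b al be P al' be' P' :
  BP a b al be -> OPab a b al be P -> BP a b al' be' -> OPab a b al' be' P' ->
  Z a b P' = Z a b P -> lambda_ a b al' be' = lambda_ a b al be.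
Proof.
move=> BPab PP BPab' PP' eqZ; apply: eq_part_Y; try exact: lambda_part.
apply/fsetP => -[i j]; rewrite (mem_Y_shape BPab' PP') (mem_Y_shape BPab PP).
by rewrite /boundary (eq_crossings BPab PP BPab' PP' eqZ) // geq_minl.
Qed.

(** All diagonal increments are 1, so the crossing numbers are [minn i j] and every boundary value
    exceeds the number of squares left on a diagonal. *)
Lemma lambda_nil a b al be P : BP a b al be -> OPab a b al be P ->
  Z a b P = fset0 -> lambda_ a b al be = [::].
Proof.
move=> BPab PP Z0; have XZ := corner_sum_crossings BPab PP.
have X i j : i <= a -> j <= b -> crossings P i j = minn i j.
  elim: i j => [|i IH] [|j] ia jb; rewrite ?(corner_row0 XZ) ?(corner_col0 XZ) ?min0n ?minn0 //.
  by have := corner_mem XZ ia jb; rewrite Z0 in_fset0 => /esym/eqP->; rewrite IH ?minnSS // ltnW.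
apply: eq_part_Y => //; first exact: lambda_part.
apply/fsetP => -[i j]; rewrite (mem_Y_shape BPab PP) mem_Y /term nth_nil.
rewrite /boundary X ?geq_minl //; lia.
Qed.

(** * Adding a point *)

Lemma Delta_adds la mu w : w \notin Y la -> Y mu = (w |` Y la)%fset ->
  Delta la mu = content w /\ Delta mu la = content w.
Proof.
move=> wla e; have d1 : (Y la `\` Y mu = fset0)%fset.
  by apply/eqP; rewrite fsetD_eq0 e fsubsetUr.
have d2 : (Y mu `\` Y la = [fset w])%fset.
  by apply/fsetP => z; rewrite e in_fsetD in_fset1U in_fset1; case: eqP => [->|_]; rewrite ?wla ?andNb.
by rewrite /Delta d1 d2 fset0U fsetU0 big_seq_fset1.
Qed.

Lemma sumn_adds la mu w : w \notin Y la -> Y mu = (w |` Y la)%fset ->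
  sumn mu = (sumn la).+1.
Proof. by move=> wla e; rewrite !sumn_Y e cardfsU1 wla. Qed.

(* The added square lies [boundary a b X t] steps before the end of its diagonal. *)
Lemma lambda_adds a b al be P al' be' P' t :
  BP a b al be -> OPab a b al be P -> BP a b al' be' -> OPab a b al' be' P' ->
  t <= a + b ->
  boundary a b (crossings P') t = (boundary a b (crossings P) t).+1 ->
  (forall u, u <= a + b -> u != t ->
    boundary a b (crossings P') u = boundary a b (crossings P) u) ->
  exists w, [/\ w \notin Y (lambda_ a b al' be'),
    Y (lambda_ a b al be) = (w |` Y (lambda_ a b al' be'))%fset &
    content w = (t%:Z - a%:Z)%R].
Proof.
move=> BPab PP BPab' PP' tab et eu.
(* This bounds [e.+1] by both coordinates of the boundary point, so that the witness has positive
   coordinates. *)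
have := corner_leq (corner_sum_crossings BPab' PP') (geq_minl a (a + b - t)) (geq_minl b t).
rewrite -/(boundary a b (crossings P') t) et; set e := boundary a b _ t => e_le.
exists (minn a (a + b - t) - e, minn b t - e); split.
- rewrite (mem_Y_shape BPab' PP').
  have -> : minn b t - e + a - (minn a (a + b - t) - e) = t by lia.
  by rewrite et -/e; lia.
- apply/fsetP => -[i j]; rewrite in_fset1U (mem_Y_shape BPab' PP') (mem_Y_shape BPab PP).
  rewrite xpair_eqE.
  case: (boolP ((1 <= i <= a) && (1 <= j <= b))) => [/andP[ia jb]|]; last by lia.
  case: (eqVneq (j + a - i) t) => [ijt|nt]; last by rewrite eu //; lia.
  by rewrite ijt et -/e; lia.
by rewrite /content /=; lia.
Qed.

Section Step.

Variables (a b : nat) (al be al' be' : seq nat) (P P' : seq (seq point)) (p q : nat).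
Hypotheses (BPab : BP a b al be) (PP : OPab a b al be P).
Hypotheses (BPab' : BP a b al' be') (PP' : OPab a b al' be' P').
Hypotheses (pa : 1 <= p <= a) (qb : 1 <= q <= b).
Hypotheses (nz : (p, q) \notin Z a b P) (eqZ : Z a b P' = ((p, q) |` Z a b P)%fset).

Let la := lambda_ a b al be.
Let la' := lambda_ a b al' be'.
Let X := crossings P.
Let X' := crossings P'.
Let t := q + a - p.

Let XZ : corner_sum a b (Z a b P) X := corner_sum_crossings BPab PP.
Let XZ' : corner_sum a b (Z a b P') X' := corner_sum_crossings BPab' PP'.

Let ZZ' : toggles p q (Z a b P) (Z a b P').
Proof.
move=> i j; rewrite eqZ in_fset1U xpair_eqE.
by case: andP => [[/eqP-> /eqP->]|_]; rewrite ?(negbTE nz) ?addbF.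
Qed.

(** A rise of the boundary value removes a square and a fall adds one. The last identity expresses
    the change of the total by plus or minus one without subtraction. *)
Lemma add_point :
  [/\ differ_by_square la la', Delta la la' = content (p, q),
      ((sumn la').+1 == sumn la) = (boundary a b X' t == (boundary a b X t).+1) &
      \sum_(u < (a + b).+1) boundary a b X' u +
        (boundary a b X' t != (boundary a b X t).+1).*2 =
      (\sum_(u < (a + b).+1) boundary a b X u).+1].
Proof.
have tab : t <= a + b by rewrite /t; lia.
have eu u : u <= a + b -> u != t -> boundary a b X' u = boundary a b X u.
  exact: (eq_boundary XZ XZ' pa qb ZZ').
have tab1 : t < (a + b).+1 by [].
have split_t Y : \sum_(u < (a + b).+1) boundary a b Y u =
    boundary a b Y t + \sum_(u < (a + b).+1 | u != Ordinal tab1) boundary a b Y u.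
  exact: (bigD1 (Ordinal tab1)).
rewrite !split_t.
have -> : \sum_(i < (a + b).+1 | i != Ordinal tab1) boundary a b X' i =
          \sum_(i < (a + b).+1 | i != Ordinal tab1) boundary a b X i.
  by apply: eq_bigr => i it; rewrite eu // -ltnS.
have ct : content (p, q) = (t%:Z - a%:Z)%R by rewrite /content /t /=; lia.
case: (boundary_toggle XZ XZ' pa qb ZZ'); rewrite -/t => et.
  have [w [wla e cw]] := lambda_adds BPab PP BPab' PP' tab et eu.
  rewrite et eqxx /= addn0 addSn; split=> //.
  - by right; exists w.
  - by rewrite ct -cw; have [] := Delta_adds wla e.
  by rewrite (sumn_adds wla e) eqxx.
have [w [wla e cw]] := lambda_adds BPab' PP' BPab PP tab et
  (fun u uab ut => esym (eu u uab ut)).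
have nt : (boundary a b X' t == (boundary a b X t).+1) = false by rewrite et; lia.
rewrite nt; split.
- by left; exists w.
- by rewrite ct -cw; have [] := Delta_adds wla e.
- by rewrite (sumn_adds wla e) -/la; lia.
by rewrite et /=; lia.
Qed.

(* If no point of [Z a b P'] lies further along the diagonal of [(p, q)], both
   corner sums grow by one at each of its later points. *)
Lemma boundary_add_point :
  (forall k, 0 < k -> (p + k, q + k) \notin Z a b P') ->
  (boundary a b X' t == (boundary a b X t).+1) = (X' p q == (X' p.-1 q.-1).+2).
Proof.
move=> diag.
have grow k : p + k <= a -> q + k <= b -> X' (p + k) (q + k) = X' p q + k /\
                                       X (p + k) (q + k) = X p q + k.
  elim: k => [|k IH] pk qk; first by rewrite !addn0.
  have [] := IH; [lia|lia|]; move=> e' e.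
  have := diag k.+1 isT; have := ZZ' (p + k.+1) (q + k.+1).
  rewrite !addnS in pk qk * => z /[dup] + /negbTE n.
  rewrite (corner_mem XZ') // negbK e' => /eqP->.
  have := corner_mem XZ pk qk; rewrite e => h.
  have : X (p + k).+1 (q + k).+1 == (X p q + k).+1.
    apply/negPn; rewrite -h; move: z; rewrite n.
    by have -> : ((p + k).+1 == p) = false; [lia|rewrite addbF => <-].
  by move=> /eqP->.
pose k := minn (a - p) (b - q).
have [pk qk] : p + k <= a /\ q + k <= b by rewrite /k; lia.
have [e' e] := grow k pk qk.
rewrite /boundary.
have -> : minn a (a + b - t) = p + k by rewrite /k /t; lia.
have -> : minn b t = q + k by rewrite /k /t; lia.
rewrite e' e -addSn eqn_add2r.
(* The two sums agree at [(p.-1, q.-1)], and [X] grows by one at [(p, q)], which is not in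
   [Z a b P]. *)
suff -> : X p q = (X' p.-1 q.-1).+1 by [].
have -> : X' p.-1 q.-1 = X p.-1 q.-1.
  apply: (eq_corner_sum XZ' XZ); [lia|lia|].
  by move=> i j ip jq; rewrite ZZ' [i.+1 == p](_ : _ = false) ?addbF //; lia.
have := corner_mem XZ (_ : p.-1 < a) (_ : q.-1 < b).
by rewrite !prednK; [rewrite (negbTE nz)|..]; lia.
Qed.

End Step.

(** * Progressions *)

Lemma mem_take_pt (s : seq point) k z :
  reflect (exists2 m, m < minn k (size s) & pt s m = z) (z \in take k s).
Proof.
apply: (iffP (nthP (0, 0))) => -[m]; rewrite size_take_min => mk.
  by rewrite nth_take; [exists m|lia].
by exists m; rewrite ?size_take_min // nth_take; last lia.
Qed.

Section Progression.

Variables (a b : nat) (s : seq point).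
Hypothesis s_uniq : uniq s.
Variables (al be : nat -> seq nat) (P : nat -> seq (seq point)).

Let lam k := lambda_ a b (al k) (be k).
Let X k := crossings (P k).
Let l := size s.

Hypothesis BPk : forall k, k <= l -> BP a b (al k) (be k).
Hypothesis PPk : forall k, k <= l -> OPab a b (al k) (be k) (P k).
Hypothesis ZPk : forall k, k <= l -> Z a b (P k) = [fset z in take k s]%fset.

Let XZ k (kl : k <= l) : corner_sum a b (Z a b (P k)) (X k) :=
  corner_sum_crossings (BPk kl) (PPk kl).

Lemma mem_Z_pt k z : k <= l ->
  reflect (exists2 m, m < k & pt s m = z) (z \in Z a b (P k)).
Proof.
move=> kl; rewrite ZPk // in_fset.
by have := mem_take_pt s k z; rewrite (minn_idPl kl).
Qed.

Lemma pt_bounds k : k < l -> 1 <= (pt s k).1 <= a /\ 1 <= (pt s k).2 <= b.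
Proof.
move=> kl; have /sub_Z_rect : pt s k \in Z a b (P k.+1) by apply/mem_Z_pt => //; exists k.
by case: (pt s k) => p q; rewrite mem_rect => /andP[].
Qed.

Lemma pt_notin_Z k : k < l -> pt s k \notin Z a b (P k).
Proof.
move=> kl; apply/negP => /mem_Z_pt[|m mk /eqP]; first exact: ltnW.
by rewrite nth_uniq // ?(ltn_trans mk kl) // ltn_eqF.
Qed.

Lemma Z_step k : k < l -> Z a b (P k.+1) = (pt s k |` Z a b (P k))%fset.
Proof.
move=> kl; apply/fsetP => z; rewrite in_fset1U.
apply/mem_Z_pt/idP => // [[m mk <-]|/orP[/eqP->|/mem_Z_pt[|m mk <-]]].
- case: (eqVneq m k) => [->|mk']; first by rewrite eqxx.
  by apply/orP; right; apply/mem_Z_pt; [exact: ltnW|exists m => //; lia].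
- by exists k.
- exact: ltnW.
by exists m => //; exact: ltnW.
Qed.

Let t k := (pt s k).2 + a - (pt s k).1.

Lemma progression_step k : k < l ->
  [/\ differ_by_square (lam k) (lam k.+1), Delta (lam k) (lam k.+1) = content (pt s k),
      ((sumn (lam k.+1)).+1 == sumn (lam k)) =
        (boundary a b (X k.+1) (t k) == (boundary a b (X k) (t k)).+1) &
      \sum_(u < (a + b).+1) boundary a b (X k.+1) u +
        (boundary a b (X k.+1) (t k) != (boundary a b (X k) (t k)).+1).*2 =
      (\sum_(u < (a + b).+1) boundary a b (X k) u).+1].
Proof.
move=> kl; have [pa qb] := pt_bounds kl; have := Z_step kl; have := pt_notin_Z kl.
rewrite /t; case: (pt s k) pa qb => p q /= pa qb nz eqZ.
exact: (add_point (BPk (ltnW kl)) (PPk (ltnW kl)) (BPk kl) (PPk kl)).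
Qed.

(** The total boundary value plus the number of steps starts at [a * b], grows by two at a deletion
    and is unchanged otherwise; [sum_boundary_card] evaluates it at the end. *)
Lemma count_decreasing :
  count (fun k => (sumn (lam k.+1)).+1 == sumn (lam k)) (iota 0 l) =
  chi a b (Z a b (P l)).
Proof.
rewrite (chi_excesses (BPk (leqnn l)) (PPk (leqnn l))).
have Zl := sum_boundary_card (XZ (leqnn l)) (@sub_Z_rect a b _).
have cl : #|` Z a b (P l)|%fset = l.
  by rewrite ZPk // take_size card_fseq undup_id.
suff : forall k, k <= l -> \sum_(u < (a + b).+1) boundary a b (X k) u + k =
    a * b + (count (fun k => (sumn (lam k.+1)).+1 == sumn (lam k)) (iota 0 k)).*2.
  by move=> /(_ l (leqnn l)); rewrite cl in Zl; rewrite Zl => /addnI/double_inj.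
elim=> [|k IH] kl.
  have Z0 : Z a b (P 0) = fset0.
    by rewrite ZPk //; apply/fsetP => z; rewrite in_fset take0.
  have := sum_boundary_card (XZ kl) (@sub_Z_rect a b _).
  have := XZ kl; rewrite Z0 => /excesses0->.
  by rewrite cardfs0.
have [_ _ eD] := progression_step kl; have := IH (ltnW kl).
rewrite (_ : iota 0 k.+1 = iota 0 k ++ [:: k]); last by rewrite -{1}addn1 iotaD.
rewrite count_cat /= addn0 eD.
by move: (\sum_(u < _) _) (\sum_(u < _) _) => u v; lia.
Qed.

Lemma canonical_decreasing k :
  (forall m n, m < n < size s -> (pt s m).1 < (pt s n).1 \/ (pt s m).2 < (pt s n).2) ->
  k < l ->
  ((sumn (lam k.+1)).+1 == sumn (lam k)) = (pt s k \in osculations a b (Z a b (P l))).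
Proof.
move=> can kl; have [_ _ -> _] := progression_step kl.
have [pa qb] := pt_bounds kl; have eqZ := Z_step kl; have nz := pt_notin_Z kl.
(* No later point lies weakly north-west of [pt s k], so the corner sums there are final. *)
have canZ i j : i.+1 <= (pt s k).1 -> j.+1 <= (pt s k).2 ->
    ((i.+1, j.+1) \in Z a b (P k.+1)) = ((i.+1, j.+1) \in Z a b (P l)).
  move=> ip jq; apply/mem_Z_pt/mem_Z_pt => // -[m mk e]; exists m => //.
    exact: leq_trans mk kl.
  by rewrite ltnS leqNgt; apply/negP => km; have := can k m; rewrite e km mk /=; lia.
(* No earlier point lies south-east of [pt s k], as [boundary_add_point] requires along the
   diagonal. *)
have diag d : 0 < d -> ((pt s k).1 + d, (pt s k).2 + d) \notin Z a b (P k.+1).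
  move=> d0; apply/negP => /mem_Z_pt[//|m mk e].
  case: (eqVneq m k) => [mk'|mk']; first by move: e; rewrite mk'; case: (pt s k) => ? ? []; lia.
  by have := can m k; rewrite e /= kl; lia.
rewrite /t; case: (pt s k) pa qb eqZ nz canZ diag => p q /= pa qb eqZ nz canZ diag.
rewrite (boundary_add_point (BPk (ltnW kl)) (PPk (ltnW kl)) (BPk kl) (PPk kl)) //.
case: p q pa qb canZ {eqZ nz diag} => [//|p] [//|q] pa qb canZ /=.
rewrite (mem_osculations (BPk (leqnn l)) (PPk (leqnn l))) //.
have eqX i j : i <= p.+1 -> j <= q.+1 -> X k.+1 i j = X l i j.
  move=> ip jq; apply: (eq_corner_sum (XZ kl) (XZ (leqnn l))); [lia|lia|].
  by move=> *; apply: canZ; lia.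
by rewrite -/(X k.+1) !eqX.
Qed.

End Progression.

Theorem theorem10 (a b : nat) (al be : seq nat) (l : nat)
    (S : {fset point}) (s : seq point) :
  0 < a -> 0 < b -> BP a b al be ->
  VOSabl a b al be l S ->
  progression a b S s ->
  exists eta : seq (seq nat),
    [/\ oscillating_tableau (lambda_ a b al be) l eta,
        profile eta = [seq content z | z <- s],
        num_deletions eta = chi a b S
      & canonical_ordering S s ->
        forall k, 1 <= k <= l ->
          (deletion eta k <-> pt s k.-1 \in osculations a b S)].
Proof.
move=> _ _ BPab [P0 [PP0 ZP0 cS]] [[us Ss] vos].
have szs : size s = l by rewrite -cS -Ss card_fseq undup_id.
(* One tuple of paths is chosen for each prefix of [s]; beyond the length of [s] the choice is a
   dummy. *)
have /choice[w wP] : forall k, exists w : seq nat * seq nat * seq (seq point),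
    k <= size s -> [/\ BP a b w.1.1 w.1.2, OPab a b w.1.1 w.1.2 w.2 &
                       Z a b w.2 = [fset z in take k s]%fset].
  move=> k; case: (leqP k (size s)) => [/vos[P [[al' [be' [? ?]]] ?]]|_].
    by exists (al', be', P).
  by exists ([::], [::], [::]).
pose al' k := (w k).1.1; pose be' k := (w k).1.2; pose P k := (w k).2.
have BPk k : k <= size s -> BP a b (al' k) (be' k) by case/wP.
have PPk k : k <= size s -> OPab a b (al' k) (be' k) (P k) by case/wP.
have ZPk k : k <= size s -> Z a b (P k) = [fset z in take k s]%fset by case/wP.
have ZPl : Z a b (P (size s)) = S by rewrite ZPk // take_size.
pose lam k := lambda_ a b (al' k) (be' k).
have [eta seta neta] : exists2 eta, size eta = l.+1 &
    forall k, k <= l -> nth [::] eta k = lam k.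
  by exists (mkseq lam l.+1) => [|k kl]; rewrite ?size_mkseq ?nth_mkseq.
have stepP := progression_step us BPk PPk ZPk; rewrite szs in stepP.
(* Tableau steps count from 1 and entries of [s] from 0: step [k.+1] handles [pt s k]. *)
have delE k : k < l -> deletion eta k.+1 = ((sumn (lam k.+1)).+1 == sumn (lam k)).
  by move=> kl; rewrite /deletion seta !neta ?ltnS ?kl // ltnW.
have iotaE : iota 1 l = [seq k.+1 | k <- iota 0 l] by rewrite (iotaDl 1 0).
exists eta; split.
- split=> //.
  + apply/allP => mu /(nthP [::])[k]; rewrite seta ltnS => kl <-; rewrite neta //.
    by apply: (lambda_part (BPk k _)); rewrite szs.
  + rewrite neta //; apply: (lambda_nil (BPk 0 _) (PPk 0 _)) => //.
    by rewrite ZPk //; apply/fsetP => z; rewrite in_fset take0.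
  (* The tuple chosen for the whole of [s] need not come with [al] and [be], but its set [Z] is
     [S]. *)
  + rewrite neta // /lam -szs; apply: (eq_lambda BPab PP0 (BPk _ _) (PPk _ _)) => //.
    by rewrite ZPl ZP0.
  by case=> // k kl; rewrite !neta ?(ltnW kl) //; have [] := stepP k kl.
- rewrite /profile seta /= iotaE -map_comp; apply: (@eq_from_nth _ 0%R).
    by rewrite !size_map size_iota.
  rewrite size_map size_iota => k kl.
  rewrite (nth_map 0) ?size_iota // nth_iota // (nth_map (0, 0)) ?szs //=.
  by rewrite !neta ?(ltnW kl) //; have [] := stepP k kl.
- rewrite /num_deletions seta /= iotaE count_map -ZPl.
  rewrite -(count_decreasing us BPk PPk ZPk) szs; apply: eq_in_count => k.
  by rewrite mem_iota /= => kl; rewrite delE.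
case=> _ can; case=> // k kl; rewrite delE // -ZPl.
by rewrite (canonical_decreasing us BPk PPk ZPk can) ?szs.
Qed.
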